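(* Consider the plane $\mathbb{R}^2$ with the elliptic (Euclidean) or the hyperbolic metric. Let $ABC$ be an arbitrary triangle with the orthocenter (the point of intersection of the three altitudes) $H$. Then the following nine points belong to the same cycle, which may be a circle (for the elliptic metric) or a hyperbola (for the hyperbolic metric): (1) the feet of the three altitudes, that is, the points of pairwise intersections of $AB$ and $CH$, of $AC$ and $BH$, and of $BC$ and $AH$; (2) the midpoints of the sides $AB$, $BC$ and $CA$; (3) the midpoints of the intervals $AH$, $BH$ and $CH$.
   Context: Points of $\mathbb{R}^2$ are written $(u,v)$. The metric is given by the bilinear form $B_\sigma\big((u,v),(u',v')\big)=uu'-\sigma vv'$, with $\sigma=-1$ for the elliptic metric and $\sigma=1$ for the hyperbolic metric. Two lines are orthogonal if their direction vectors $w,w'$ satisfy $B_\sigma(w,w')=0$. An altitude of a triangle is the line through a vertex orthogonal to the line containing the opposite side. The midpoint of an interval $PQ$ is $\frac12(P+Q)$. A cycle is a curve given by an equation $k(u^2-\sigma v^2)-2lu-2nv+m=0$ with real coefficients $(k,l,n,m)$ taken up to a common non-zero factor; for $k\neq0$ this is a circle if $\sigma=-1$ and an equilateral hyperbola with a vertical axis of symmetry if $\sigma=1$. *)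

(* Defs.v *)
From mathcomp Require Import all_boot all_order all_algebra.
From mathcomp Require Import classical_sets reals.

Set Implicit Arguments.
Unset Strict Implicit.
Unset Printing Implicit Defensive.

Import GRing.Theory.

Local Open Scope classical_set_scope.
Local Open Scope ring_scope.

(* [R^o] makes the scalars of the product module [R] itself. *)
Notation plane R := (R^o * R^o)%type.

Variant metric := Elliptic | Hyperbolic.

Definition sigma (R : realType) (g : metric) : R :=
  match g with Elliptic => - 1 | Hyperbolic => 1 end.

Definition bform (R : realType) (g : metric) (w w' : plane R) : R :=
  w.1 * w'.1 - sigma R g * w.2 * w'.2.

Definition line (R : realType) (P w : plane R) : set (plane R) :=
  [set P + t *: w | t in [set: R]].

Definition is_line (R : realType) (L : set (plane R)) : Prop :=
  exists P w : plane R, w <> 0 /\ L = line P w.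

(* A line only when [P <> Q], as is the case for two vertices of a triangle. *)
Definition line_through (R : realType) (P Q : plane R) : set (plane R) :=
  line P (Q - P).

Definition triangle (R : realType) (A B C : plane R) : Prop :=
  ~ exists L : set (plane R), [/\ is_line L, L A, L B & L C].

(* Direction vectors are unique up to a non-zero factor, so it does not matter
   which ones are chosen. *)
Definition orthogonal_lines (R : realType) (g : metric)
    (L L' : set (plane R)) : Prop :=
  exists P w P' w' : plane R,
    [/\ w <> 0, w' <> 0, L = line P w, L' = line P' w' & bform g w w' = 0].

Definition altitude (R : realType) (g : metric) (A B C : plane R)
    (L : set (plane R)) : Prop :=
  L A /\ orthogonal_lines g L (line_through B C).

Definition midpoint (R : realType) (P Q : plane R) : plane R := 2^-1 *: (P + Q).

(* Proportional coefficients give different records but the same curve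
   [cycle_points]. *)
Record plane_cycle (R : realType) := Cycle {
  cyc_k : R; cyc_l : R; cyc_n : R; cyc_m : R;
  cycle_neq0 : (cyc_k, cyc_l, cyc_n, cyc_m) <> (0, 0, 0, 0) }.

Definition cycle_points (R : realType) (g : metric) (c : plane_cycle R) :
    set (plane R) :=
  [set P | cyc_k c * (P.1 ^+ 2 - sigma R g * P.2 ^+ 2)
           - 2 * cyc_l c * P.1 - 2 * cyc_n c * P.2 + cyc_m c = 0].

(* A circle for the elliptic metric, an equilateral hyperbola with a vertical
   axis of symmetry for the hyperbolic one.  The hyperbola may degenerate into
   its two asymptotes. *)
Definition circle_or_hyperbola (R : realType) (c : plane_cycle R) : Prop :=
  cyc_k c <> 0.

(* Main.v *)
Require Import Defs.
From mathcomp Require Import all_boot all_order all_algebra.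
From mathcomp Require Import classical_sets reals.
From mathcomp Require Import ring.

Import GRing.Theory Num.Theory.

Local Open Scope classical_set_scope.
Local Open Scope ring_scope.

(** Write [B] for the bilinear form.  The proof is the one by diameters: consider
    the cycle of all points [X] with
      [B (2 X - (A + B), 2 X - (C + H)) = 0],
    whose diameter joins the midpoints of [AB] and of [CH].  These two midpoints
    lie on it trivially, and so does the foot [X] of the altitude from [C], since
    there [2 X - (A + B)] is a multiple of [B - A] while [2 X - (C + H)], the sum
    of [X - C] and [X - H], is orthogonal to [B - A].  Expanding, the equation is
      [4 B (X, X) - 2 B (X, A + B + C + H) + B (A + B, C + H) = 0],
    which depends on the way the four points are paired only through its constant
    term; and [B (A + B, C + H) - B (B + C, A + H)] equals [B (H - B, A - C)],
    which vanishes because [BH] is an altitude.  So the three pairings of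
    [A, B, C, H] give one and the same cycle ([nine_point_cycle_rot]), and each
    of them accounts for three of the nine points. *)

Lemma altitude_ortho {R : realType} {g : metric} {A B C X : plane R}
    {L : set (plane R)} :
  altitude g A B C L -> L X -> bform g (X - A) (C - B) = 0.
Proof.
move=> [LA [P [w [P' [w' [_ _ eL eBC ww']]]]]] LX.
have lineB : line_through B C B by exists 0 => //; rewrite scale0r addr0.
have lineC : line_through B C C by exists 1 => //; rewrite scale1r addrC subrK.
move: LA LX lineB lineC; rewrite {}eBC {}eL.
move=> [a _ <-] [x _ <-] [b _ <-] [c _ <-].
transitivity ((x - a) * (c - b) * bform g w w'); last by rewrite ww' mulr0.
by rewrite /bform /= /GRing.scale /=; ring.
Qed.

Lemma line_throughC {R : realType} (P Q : plane R) :
  line_through P Q `<=` line_through Q P.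
Proof.
move=> _ [t _ <-]; exists (1 - t) => //.
by rewrite scalerBl scale1r addrA subrKC -scalerN opprB.
Qed.

Lemma nine_point_coef_neq0 {R : realType} (l n m : R) :
  (4 : R, l, n, m) <> (0, 0, 0, 0).
Proof. by case=> /eqP; rewrite pnatr_eq0. Qed.

(** The cycle [B (2 X - (A + B), 2 X - (C + H)) = 0], in expanded form. *)
Definition nine_point_cycle {R : realType} (g : metric) (A B C H : plane R) :
    plane_cycle R :=
  Cycle (nine_point_coef_neq0 (A + B + C + H).1
           (- sigma R g * (A + B + C + H).2) (bform g (A + B) (C + H))).

Lemma nine_point_cycleE {R : realType} {g : metric} (A B C H X : plane R) :
  cycle_points g (nine_point_cycle g A B C H) X <->
  bform g (2 *: X - (A + B)) (2 *: X - (C + H)) = 0.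
Proof.
rewrite /cycle_points /= /bform /= /GRing.scale /=.
set e := (X in X = 0 <-> _); set f := (X in _ <-> X = 0).
by have -> : e = f by rewrite /e /f; ring.
Qed.

Lemma nine_point_cycle_rot {R : realType} {g : metric} {A B C H : plane R} :
  bform g (H - B) (A - C) = 0 ->
  cycle_points g (nine_point_cycle g B C A H) =
  cycle_points g (nine_point_cycle g A B C H).
Proof.
move=> ortho.
have const_eq : bform g (B + C) (A + H) = bform g (A + B) (C + H).
  by apply/esym/subr0_eq; rewrite -ortho /bform /=; ring.
have sum_eq : B + C + A + H = A + B + C + H by rewrite (addrC (B + C)) addrA.
by rewrite /nine_point_cycle const_eq sum_eq.
Qed.

Lemma midpoint_in_nine_point_cycle {R : realType} (g : metric)
    (A B C H : plane R) :
  cycle_points g (nine_point_cycle g A B C H) (midpoint A B) /\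
  cycle_points g (nine_point_cycle g A B C H) (midpoint C H).
Proof.
have double P Q : 2 *: midpoint P Q = P + Q :> plane R.
  by rewrite /midpoint scalerA divff ?scale1r // pnatr_eq0.
split; apply/nine_point_cycleE; rewrite double subrr /bform /=; ring.
Qed.

Lemma foot_in_nine_point_cycle {R : realType} (g : metric)
    {A B C H X : plane R} :
  bform g (H - C) (B - A) = 0 -> bform g (X - C) (B - A) = 0 ->
  line_through A B X -> cycle_points g (nine_point_cycle g A B C H) X.
Proof.
move=> orthoH orthoX [t _ eX]; apply/nine_point_cycleE.
(* [2 X - (C + H)] is [2 (X - C) - (H - C)], and
   [2 X - (A + B)] is [(2 t - 1) (B - A)]. *)
transitivity ((2 * t - 1) *
    (2 * bform g (X - C) (B - A) - bform g (H - C) (B - A))).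
  by rewrite -eX /bform /= /GRing.scale /=; ring.
by rewrite orthoH orthoX mulr0 subrr mulr0.
Qed.

Theorem theorem6p1 (R : realType) (g : metric) (A B C H : plane R)
    (hA hB hC : set (plane R)) :
  triangle A B C ->
  altitude g A B C hA -> altitude g B C A hB -> altitude g C A B hC ->
  hA H -> hB H -> hC H ->
  exists c : plane_cycle R,
    [/\ circle_or_hyperbola c,
        [/\ line_through A B `&` hC `<=` cycle_points g c,
            line_through A C `&` hB `<=` cycle_points g c
          & line_through B C `&` hA `<=` cycle_points g c],
        [/\ cycle_points g c (midpoint A B),
            cycle_points g c (midpoint B C)
          & cycle_points g c (midpoint C A)]
      & [/\ cycle_points g c (midpoint A H),
            cycle_points g c (midpoint B H)
          & cycle_points g c (midpoint C H)]].
Proof.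
move=> _ altA altB altC HA HB HC.
have oA := altitude_ortho altA HA.
have oB := altitude_ortho altB HB.
have oC := altitude_ortho altC HC.
have rotBCA := nine_point_cycle_rot oB.
have rotCAB := nine_point_cycle_rot oC.
rewrite rotBCA in rotCAB.
have [mAB mCH] := midpoint_in_nine_point_cycle g A B C H.
have [mBC mAH] := midpoint_in_nine_point_cycle g B C A H.
have [mCA mBH] := midpoint_in_nine_point_cycle g C A B H.
rewrite rotBCA in mBC mAH; rewrite rotCAB in mCA mBH.
exists (nine_point_cycle g A B C H); split.
- by apply/eqP; rewrite pnatr_eq0.
- split=> X [].
  + move=> XAB XC; apply: foot_in_nine_point_cycle XAB => //.
    exact: altitude_ortho altC XC.
  + move=> /line_throughC XCA XB; rewrite -rotCAB.
    apply: foot_in_nine_point_cycle XCA => //.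
    exact: altitude_ortho altB XB.
  + move=> XBC XA; rewrite -rotBCA.
    apply: foot_in_nine_point_cycle XBC => //.
    exact: altitude_ortho altA XA.
- by split.
- by split.
Qed.
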